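(* Assume that $Q$ is subcritical in $X$ and let $u$ be a positive solution of $Q'[\varphi]=0$ of minimal growth at infinity in $X$. Then $$\mathcal H\subseteq \ell^1(X,u^p m),$$ or equivalently, if $g\in\mathcal H$, then $u\in\ell^p(X,|g|m)$, i.e. $\sum_{x\in X}m(x)|g(x)||u(x)|^p<\infty$.
   Context: Setting: $p\in(1,\infty)$; $X$ is an infinite countable set with the discrete topology, and $K\Subset X$ means that $K$ is a finite subset of $X$. $m:X\to(0,\infty)$ is a measure of full support. $C(X)$ is the set of all functions $X\to\mathbb{R}$ and $C_c(X)$ the set of finitely supported ones. $b:X\times X\to[0,\infty)$ is a connected graph over $(X,m)$: symmetric, zero diagonal, $\sum_{y}b(x,y)<\infty$ for all $x$, and any two vertices are joined by a finite path along which $b>0$. $c:X\to\mathbb{R}$ is a potential. Write $\nabla_{xy}f=f(x)-f(y)$. The energy functional is $$Q(\varphi)=\tfrac12\sum_{x,y\in X}b(x,y)|\nabla_{xy}\varphi|^p+\sum_{x\in X}c(x)|\varphi(x)|^p,\quad \varphi\in C_c(X),$$ and it is assumed that $Q\ge0$ on $C_c(X)$. Let $\mathcal F(X)=\{f\in C(X): \sum_y b(x,y)|\nabla_{xy}f|^{p-1}<\infty \text{ for all }x\}$ and, for $f\in\mathcal F(X)$, $$Q'[f](x)=\frac1{m(x)}\sum_{y}b(x,y)|\nabla_{xy}f|^{p-2}\nabla_{xy}f+\frac{c(x)}{m(x)}|f(x)|^{p-2}f(x)$$ (with $|0|^{p-2}0=0$). The space of Hardy weights is $\mathcal H=\{g\in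 C(X):\exists\,C>0\ \forall\varphi\in C_c(X):\ C\sum_X m|g||\varphi|^p\le Q(\varphi)\}$. $Q$ is called subcritical in $X$ if $\mathcal H\ne\{0\}$. A function $u\in\mathcal F(X)$ is called a positive solution of $Q'[\varphi]=0$ of minimal growth at infinity in $X$ if $u>0$ and $Q'[u]=0$ in $X\setminus K_0$ for some $K_0\Subset X$, and for any $v\in\mathcal F(X)$ such that $v>0$ and $Q'[v]\ge0$ in $X\setminus K$ for some $K\Subset X$ with $K_0\subseteq K$ and such that $u\le v$ on $K$, one has $u\le v$ in $X\setminus K$. *)

(* Defs.v *)
From HB Require Import structures.
From mathcomp Require Import all_boot all_order all_algebra.
From mathcomp Require Import mathcomp_extra boolp classical_sets functions.
From mathcomp Require Import cardinality fsbigop reals ereal numfun esum exp.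

Set Implicit Arguments.
Unset Strict Implicit.
Unset Printing Implicit Defensive.

Import Order.TTheory GRing.Theory Num.Theory.

Local Open Scope classical_set_scope.
Local Open Scope ring_scope.

Section quasilinear_schroedinger_on_graphs.
Context {R : realType} {X : countType}.
Implicit Types (p q : R) (m c : X -> R) (b : X -> X -> R).
Implicit Types (f g u v phi w : X -> R) (K : set X).

Definition connected_graph b : Prop :=
  [/\ forall x y, 0 <= b x y,
      forall x y, b x y = b y x,
      forall x, b x x = 0,
      forall x, (\esum_(y in [set: X]) (b x y)%:E < +oo)%E
    & forall x y, exists s : seq X,
        path (fun z t => 0 < b z t) x s /\ last x s = y].

Definition finitely_supported : set (X -> R) :=
  [set phi | finite_set [set x | phi x != 0]].

(* The first sum runs over non-negative terms and is taken in [0, +oo]; it is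
   finite on finitely supported functions over a graph.  For such functions
   the second sum has finite support ([\sum_(x \in _)] is 0 otherwise). *)
Definition energy p b c phi : \bar R :=
  ((2^-1)%:E * (\esum_(z in [set: X * X])
                  (b z.1 z.2 * `|phi z.1 - phi z.2| `^ p)%:E)
   + (\sum_(x \in [set: X]) c x * `|phi x| `^ p)%:E)%E.

Definition energy_nonneg p b c : Prop :=
  forall phi, finitely_supported phi -> (0 <= energy p b c phi)%E.

(* Sum of an absolutely summable real family (junk value otherwise). *)
Definition rsum (F : X -> R) : R :=
  fine (esum [set: X] (EFin \o F)^\+ - esum [set: X] (EFin \o F)^\-)%E.

(* The factor t makes this vanish at t = 0, whatever the value of 0 `^ (p - 2). *)
Definition ppow p (t : R) : R := `|t| `^ (p - 2) * t.

Definition formal_domain p b : set (X -> R) :=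
  [set f | forall x,
    (\esum_(y in [set: X]) (b x y * `|f x - f y| `^ (p - 1))%:E < +oo)%E].

Definition schroedinger p m b c f (x : X) : R :=
  (m x)^-1 * rsum (fun y => b x y * ppow p (f x - f y))
  + c x / m x * ppow p (f x).

Definition hardy_weights p m b c : set (X -> R) :=
  [set g | exists2 C : R, 0 < C &
     forall phi, finitely_supported phi ->
       ((C * \sum_(x \in [set: X]) m x * `|g x| * `|phi x| `^ p)%:E
          <= energy p b c phi)%E].

Definition subcritical p m b c : Prop :=
  hardy_weights p m b c <> [set (fun=> 0)].

(* Positivity, like the (in)equality for Q', is required only outside K0
   (resp. K). *)
Definition minimal_growth_solution p m b c u : Prop :=
  formal_domain p b u /\
  exists K0 : set X,
    [/\ finite_set K0,
        forall x, ~ K0 x -> 0 < u x /\ schroedinger p m b c u x = 0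
      & forall v K, formal_domain p b v ->
          finite_set K -> K0 `<=` K ->
          (forall x, ~ K x -> 0 < v x /\ 0 <= schroedinger p m b c v x) ->
          (forall x, K x -> u x <= v x) ->
          forall x, ~ K x -> u x <= v x].

Definition ell q w : set (X -> R) :=
  [set f | (\esum_(x in [set: X]) (`|f x| `^ q * w x)%:E < +oo)%E].

End quasilinear_schroedinger_on_graphs.

(* Main.v *)
Require Import Defs.
From mathcomp Require Import all_boot all_order all_algebra.
From mathcomp Require Import ring lra.
From mathcomp Require Import boolp classical_sets functions.
From mathcomp Require Import cardinality fsbigop reals ereal esum exp.
From mathcomp Require Import filter topology function_spaces normedtype.
From mathcomp Require Import sequences derive.

(* On an exhaustion of X by finite sets, minimise the energy over the
   functions supported in the n-th set that are non-negative and lie above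
   |u| + 1 on a finite set K containing K0 and a vertex o with g0(o) <> 0 for
   some Hardy weight g0.  The minimisers phi_n are supersolutions inside the
   n-th set, and their energies are bounded.  The Hardy inequality for g0
   bounds phi_n(o), and a Harnack inequality along paths then bounds phi_n at
   every vertex, so phi_n converges pointwise along an ultrafilter to some v.
   By Fatou's lemma v is a positive supersolution on X, hence u <= v outside K
   by minimal growth.  For any Hardy weight g, Fatou's lemma applied to the
   Hardy inequality for phi_n bounds the sum of m |g| v^p, and |u| <= v. *)

Set Implicit Arguments.
Unset Strict Implicit.
Unset Printing Implicit Defensive.

Import Order.TTheory GRing.Theory Num.Theory.
Import numFieldNormedType.Exports.
Local Open Scope classical_set_scope.
Local Open Scope ring_scope.

(** * Unordered sums, Fatou's lemma and limits along ultrafilters *)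

Section esum_facts.
Context {R : realType} {T : choiceType}.

(* Fatou's lemma. *)
Lemma esum_le_cvg {F : set_system nat} {FF : ProperFilter F}
    (h : nat -> T -> R) (k : T -> R) (a : nat -> R) (l : R) :
  (forall x, h ^~ x @ F --> k x) -> a @ F --> l ->
  (\forall i \near F, \esum_(x in [set: T]) (h i x)%:E <= (a i)%:E)%E ->
  (\esum_(x in [set: T]) (k x)%:E <= l%:E)%E.
Proof.
move=> hk al ha; apply: ge_ereal_sup => _ [A [finA _] <-].
rewrite fsbig_finite//= sumEFin lee_fin.
apply: (@ler_cvg_to _ F _ _
  (fun i => \sum_(x <- finmap.enum_fset (fset_set A)) h i x) a) => //.
  by apply: cvg_big => //; exact: add_continuous.
near=> i; rewrite -lee_fin -sumEFin -fsbig_finite//.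
apply: (@le_trans _ _ (\esum_(x in [set: T]) (h i x)%:E)%E); last by near: i.
by apply: esum_ge; exists A.
Unshelve. all: end_near. Qed.

Lemma esumZ (k : R) (a : T -> R) : 0 <= k -> (forall x, 0 <= a x) ->
  (\esum_(x in [set: T]) (k * a x)%:E =
    k%:E * \esum_(x in [set: T]) (a x)%:E)%E.
Proof.
have le_esumZ (j : R) (h : T -> R) : 0 <= j -> (forall x, 0 <= h x) ->
    (\esum_(x in [set: T]) (j * h x)%:E <=
      j%:E * \esum_(x in [set: T]) (h x)%:E)%E.
  move=> j0 h0; apply: ge_ereal_sup => _ [A [finA _] <-].
  rewrite fsumEFin// -mulr_fsumr EFinM lee_wpmul2l ?lee_fin//.
  by apply: esum_ge; exists A => //; rewrite fsumEFin.
move=> k0 a0; apply/eqP; rewrite eq_le le_esumZ//=.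
have [->|kN0] := eqVneq k 0.
  by rewrite mul0e esum_ge0// => x _; rewrite mul0r.
have {kN0} k0 : 0 < k by rewrite lt_neqAle eq_sym kN0.
rewrite -lee_pdivlMl//.
(* The reverse inequality is the first one for the scalar [k^-1]. *)
have := @le_esumZ k^-1 (fun x => k * a x).
rewrite invr_ge0 ltW// => /(_ isT) /(_ (fun x => mulr_ge0 (ltW k0) (a0 x))).
by under eq_esum do rewrite mulKf ?gt_eqF//.
Qed.

Lemma esum_finite_support (a : T -> R) :
  (forall x, 0 <= a x) -> finite_set [set x | a x != 0] ->
  (\esum_(x in [set: T]) (a x)%:E = (\sum_(x \in [set: T]) a x)%:E)%E.
Proof.
move=> a0 fina; set S := [set x | a x != 0].
rewrite -(@fsbig_widen _ _ _ _ S setT)//; last first.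
  by move=> x [_ /=]; rewrite /S /= => /negP; rewrite negbK => /eqP.
rewrite -fsumEFin// -esum_fset//; last by move=> *; rewrite lee_fin.
rewrite (esum_mkcond S); apply: eq_esum => x _.
case: ifPn => //; rewrite notin_setE /S/= => /negP; rewrite negbK => /eqP ->//.
Qed.

(** Compactness of [[0, B]], as the image of an ultrafilter is an ultrafilter. One ultrafilter
    serves all vertices at once, in place of a diagonal subsequence. *)
Lemma ultra_cvg_bounded {I : Type} {U : set_system I} {UU : UltraFilter U}
    (f : I -> R) (B : R) :
  (\forall i \near U, 0 <= f i <= B) -> exists l : R, f @ U --> l.
Proof.
move=> fB; have := @segment_compact R 0 B.
rewrite compact_ultra => /(_ (f @ U)).
case=> [| |l [_ fl]]; last by exists l.
  split; first exact: fmap_proper_filter.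
  move=> G GG fUG; apply/seteqP; split=> [A GA|]; last exact: fUG.
  have [//|UA] := in_ultra_setVsetC (f @^-1` A) UU.
  have /fUG GCA : (f @ U) (~` A) by [].
  have : G (A `&` ~` A) by exact: filterI.
  by move=> /filter_ex[? []].
by apply: filterS fB => i; rewrite /= in_itv.
Qed.

End esum_facts.

(** * The p-th power of the absolute value, and [ppow], its derivative up to the factor [p] *)

Section ppow_facts.
Context {R : realType}.
Variable p : R.
Hypothesis p_gt1 : 1 < p.

Let p1_gt0 : 0 < p - 1. Proof. by rewrite subr_gt0. Qed.

Lemma ge0_ppow t : 0 <= t -> ppow p t = t `^ (p - 1).
Proof.
move=> t0; rewrite /ppow ger0_norm// -(mulr_powRB1 t0 p1_gt0) mulrC.
by congr (_ * _ `^ _); ring.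
Qed.

Lemma ppowN t : ppow p (- t) = - ppow p t.
Proof. by rewrite /ppow normrN mulrN. Qed.

Lemma normr_ppow t : `|ppow p t| = `|t| `^ (p - 1).
Proof. by rewrite -ge0_ppow// /ppow normrM normr_id ger0_norm// powR_ge0. Qed.

Lemma ppow_ge0 t : 0 <= t -> 0 <= ppow p t.
Proof. by move=> t0; rewrite mulr_ge0 ?powR_ge0. Qed.

Lemma ppow_le s a : 0 <= a -> s <= a -> ppow p s <= ppow p a.
Proof.
move=> a0 sa; have [s0|s0] := leP 0 s.
  by rewrite !ge0_ppow// ge0_ler_powR ?nnegrE// ltW.
apply: le_trans (ppow_ge0 a0).
by rewrite /ppow mulr_ge0_le0 ?powR_ge0// ltW.
Qed.

Lemma ppowMid s : ppow p s * s = `|s| `^ p.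
Proof.
rewrite -(mulr_powRB1 (normr_ge0 s) (lt_trans ltr01 p_gt1)) -normr_ppow mulrC.
rewrite -normrM ger0_norm// /ppow mulrCA mulr_ge0 ?powR_ge0//.
by rewrite -expr2 sqr_ge0.
Qed.

(* [t |-> |t| `^ p] lies above its tangent at [s], by Young's inequality. *)
Lemma powR_tangent s a : `|s| `^ p + p * ppow p s * (a - s) <= `|a| `^ p.
Proof.
have p0 : 0 < p by exact: lt_trans ltr01 p_gt1.
have : ppow p s * a <= `|a| `^ p / p + `|s| `^ p / (p / (p - 1)).
  apply: (le_trans (ler_norm _)); rewrite normrM normr_ppow mulrC.
  have := @conjugate_powR _ `|a| (`|s| `^ (p - 1)) p (p / (p - 1)).
  rewrite -powRrM mulrCA divff ?gt_eqF// mulr1; apply => //.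
  - by rewrite divr_gt0.
  - by field; rewrite !gt_eqF.
rewrite -(ler_pM2l p0).
have -> : p * ppow p s * (a - s) =
  p * (ppow p s * a) - p * (ppow p s * s) by ring.
rewrite ppowMid.
have -> : p * (`|a| `^ p / p + `|s| `^ p / (p / (p - 1))) =
  `|a| `^ p + (p - 1) * `|s| `^ p by field; rewrite !gt_eqF.
lra.
Qed.

Lemma continuous_powR_norm_neq0 r (t : R) : t != 0 ->
  {for t, continuous (fun s : R => `|s| `^ r)}.
Proof.
move=> t0.
have ct : {for t, continuous (fun s : R => `|s|)}.
  exact: (@norm_continuous _ R).
apply: (@continuous_comp _ _ _ (fun s : R => `|s|) (fun s : R => s `^ r) t ct).
apply: (@differentiable_continuous _ R R); apply/derivable1_diffP.
by apply: derivable_powR; rewrite in_itv/= andbT normr_gt0.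
Qed.

Lemma continuous_powR_norm r : 0 < r -> continuous (fun t : R => `|t| `^ r).
Proof.
move=> r0 t; have [->|t0] := eqVneq t 0; last first.
  exact: continuous_powR_norm_neq0.
rewrite /continuous_at normr0 powR0 ?gt_eqF//.
apply/cvgrPdist_lt => e e0.
have := @powR_cvg0 R r r0 => /cvgrPdist_lt /(_ e e0).
rewrite near_withinE => /(@nbhs_ballP R R) [d /= d0 dP].
near=> s; rewrite sub0r normrN ger0_norm ?powR_ge0//.
(* [powR_cvg0] is a limit along positive reals, so [s = 0] is checked apart. *)
have [->|s0] := eqVneq s 0; first by rewrite normr0 powR0 ?gt_eqF.
suff sd : `|s| < d.
  have := dP `|s|; rewrite /ball/= !sub0r !normrN normr_id normr_gt0.
  by rewrite (ger0_norm (powR_ge0 _ _)); apply.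
near: s.
apply/nbhs_ballP; exists d => // z.
by rewrite /ball/= sub0r normrN.
Unshelve. all: end_near. Qed.

Lemma continuous_ppow : continuous (ppow p).
Proof.
move=> t; have [->|t0] := eqVneq t 0; last first.
  rewrite /ppow.
  apply: (@continuousM _ _ (fun t : R => `|t| `^ (p - 2)) id) => //.
  exact: continuous_powR_norm_neq0.
(* If [p < 2], the factor with exponent [p - 2] is unbounded near 0. Continuity there comes from the
   absolute value of [ppow], a power with exponent [p - 1 > 0]. *)
have := @continuous_powR_norm (p - 1) p1_gt0 0.
rewrite /continuous_at normr0 powR0 ?gt_eqF// {2}/ppow mulr0 => h.
apply/norm_cvg0P.
by under eq_cvg do rewrite normr_ppow.
Qed.

End ppow_facts.

(** * Supersolutions: limits, Harnack inequality, and the link with [Q'] *)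

Section supersolutions.
Context {R : realType} {X : countType}.
Variables (p : R) (b : X -> X -> R).
Hypotheses (p_gt1 : 1 < p) (b_graph : connected_graph b).

Let p1_gt0 : 0 < p - 1. Proof. by rewrite subr_gt0. Qed.
Let b_ge0 x y : 0 <= b x y. Proof. by case: b_graph. Qed.

Definition degree x : R := fine (\esum_(y in [set: X]) (b x y)%:E)%E.

Lemma esum_degree x : (\esum_(y in [set: X]) (b x y)%:E = (degree x)%:E)%E.
Proof.
rewrite /degree fineK// ge0_fin_numE.
  by case: b_graph => _ _ _ + _; exact.
by apply: esum_ge0 => y _; rewrite lee_fin.
Qed.

Lemma degree_ge0 x : 0 <= degree x.
Proof. by rewrite fine_ge0// esum_ge0// => y _; rewrite lee_fin. Qed.

(* The inequality [Q'[f](x) >= 0] for [f >= 0] and [k = c x], with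
   [degree x * ppow p (f x)] added on both sides to make the left-hand terms
   non-negative. *)
Definition supersolution (k : R) (f : X -> R) (x : X) : Prop :=
  (\esum_(y in [set: X]) (b x y * (ppow p (f x) - ppow p (f x - f y)))%:E
     <= ((k + degree x) * ppow p (f x))%:E)%E.

Lemma supersolution_term_ge0 (f : X -> R) x y : (forall z, 0 <= f z) ->
  0 <= b x y * (ppow p (f x) - ppow p (f x - f y)).
Proof.
move=> f0; by rewrite mulr_ge0// subr_ge0 ppow_le// gerBl.
Qed.

(** By Fatou's lemma, no domination over the possibly infinitely many neighbours of [x] is
    needed. *)
Lemma supersolution_cvg (F : set_system nat) (FF : ProperFilter F)
    (k : nat -> R) (f : nat -> X -> R) l g x :
  k @ F --> l -> (forall y, f ^~ y @ F --> g y) ->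
  (\forall n \near F, supersolution (k n) (f n) x) -> supersolution l g x.
Proof.
move=> kl fg; apply: esum_le_cvg => [y|].
  apply: cvgMr; apply: cvgB.
    by apply: continuous_cvg => //; exact: continuous_ppow.
  apply: continuous_cvg; first exact: continuous_ppow.
  by apply: cvgB.
apply: cvgM; first by apply: cvgD => //; exact: cvg_cst.
by apply: continuous_cvg => //; exact: continuous_ppow.
Qed.

(** If [f y > f x], the term of [y] alone is [b x y] times the sum of the powers of [f x] and of
    [f y - f x] with exponent [p - 1]. The whole sum bounds it, and taking roots bounds [f y - f x]
    by a multiple of [f x]. Only the upper bound [k0] of [k] enters the constant. *)
Lemma supersolution_neighbour x y (k0 : R) : 0 < b x y ->
  exists2 C, 0 <= C & forall k f, k <= k0 -> (forall z, 0 <= f z) ->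
    supersolution k f x -> f y <= C * f x.
Proof.
move=> bxy; set B := (`|k0| + degree x) / b x y.
have B0 : 0 <= B by rewrite divr_ge0 ?addr_ge0 ?degree_ge0.
exists (1 + B `^ (p - 1)^-1); first by rewrite addr_ge0 ?powR_ge0.
move=> k f kk0 f0 fx.
have [yx|xy] := leP (f y) (f x).
  by apply: (le_trans yx); rewrite mulrDl mul1r lerDl mulr_ge0 ?powR_ge0.
have : b x y * (ppow p (f x) - ppow p (f x - f y)) <=
    (k + degree x) * ppow p (f x).
  rewrite -lee_fin; apply: le_trans fx; apply: esum_ge; exists [set y] => //.
  by rewrite fsbig_set1.
rewrite -(opprB (f y)) ppowN opprK (ge0_ppow p_gt1 (f0 x)).
rewrite (ge0_ppow p_gt1); last by rewrite subr_ge0 ltW.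
move=> h.
have : (f y - f x) `^ (p - 1) <= (B `^ (p - 1)^-1 * f x) `^ (p - 1).
  rewrite powRM ?powR_ge0// -powRrM mulVf ?gt_eqF// powRr1//.
  rewrite /B mulrAC ler_pdivlMr// mulrC.
  apply: le_trans (_ : (k + degree x) * f x `^ (p - 1) <= _).
    by apply: le_trans h; rewrite ler_wpM2l// lerDr powR_ge0.
  by rewrite ler_wpM2r ?powR_ge0// lerD2r (le_trans kk0)// ler_norm.
move=> h2; rewrite mulrDl mul1r -lerBlDl [leLHS]/= leNgt.
apply/negP => h3; move: h2; rewrite leNgt => /negP; apply.
apply: gt0_ltr_powR => //.
  by rewrite nnegrE mulr_ge0 ?powR_ge0.
by rewrite nnegrE subr_ge0 ltW.
Qed.

(* A Harnack inequality, with a constant uniform along the filter. *)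
Lemma supersolution_comparable (F : set_system nat) (FF : Filter F)
    (k : nat -> X -> R) (k0 : X -> R) (f : nat -> X -> R) :
  (forall n x, k n x <= k0 x) -> (forall n x, 0 <= f n x) ->
  (forall x, \forall n \near F, supersolution (k n x) (f n) x) ->
  forall x y, exists2 C, 0 <= C & \forall n \near F, f n y <= C * f n x.
Proof.
move=> kk0 f0 fs x y; case: b_graph => _ _ _ _ /(_ x y)[s [+ <-]].
elim: s x => [|z s IH] x /=.
  by move=> _; exists 1 => //; near=> n; rewrite mul1r.
move=> /andP[/(supersolution_neighbour (k0 x)) [C1 C10 hC1]] /IH[C2 C20 hC2].
exists (C2 * C1); first exact: mulr_ge0.
near=> n; apply: (@le_trans _ _ (C2 * f n z)); first by near: n.
rewrite -mulrA ler_wpM2l// (hC1 (k n x))//.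
by near: n; exact: fs.
Unshelve. all: end_near. Qed.

(** Since [t = ppow p (f x - f y)] is at most [A = ppow p (f x)], one has [|t| <= (A - t) + A]; the
    supersolution inequality sums the first part and the degree the second. *)
Lemma supersolution_formal_domain (c f : X -> R) : (forall x, 0 <= f x) ->
  (forall x, supersolution (c x) f x) -> formal_domain p b f.
Proof.
move=> f0 fs x; set A := ppow p (f x).
have A0 : 0 <= A by exact: ppow_ge0.
apply: (@le_lt_trans _ _ (((c x + degree x) * A)%:E + (A * degree x)%:E)%E);
  last exact: ltry.
rewrite [(A * _)%:E]EFinM -esum_degree -esumZ//.
apply: (@le_trans _ _ (\esum_(y in [set: X])
     (b x y * (A - ppow p (f x - f y)))%:E
   + \esum_(y in [set: X]) (A * b x y)%:E)%E); last exact: leeD2r (fs x).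
rewrite -esumD; last first.
- by move=> y _; rewrite lee_fin mulr_ge0.
- by move=> y _; rewrite lee_fin supersolution_term_ge0.
apply: le_esum => y _; rewrite -EFinD lee_fin (mulrC A) -mulrDr ler_wpM2l//.
rewrite -normr_ppow//.
have tA : ppow p (f x - f y) <= A by rewrite ppow_le// gerBl.
by rewrite ler_norml; apply/andP; split; lra.
Qed.

(** The degree term added in [supersolution] is taken off again: the summand in [Q'] is
    [A * b x y - G y], a difference of non-negative summable families, so [rsum] is a difference of
    finite sums. *)
Lemma supersolution_schroedinger_ge0 (m c f : X -> R) x : 0 < m x ->
  (forall z, 0 <= f z) -> supersolution (c x) f x ->
  0 <= schroedinger p m b c f x.
Proof.
move=> m0 f0 fs; set A := ppow p (f x).
have A0 : 0 <= A by exact: ppow_ge0.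
set G := fun y => b x y * (A - ppow p (f x - f y)).
have G0 y : 0 <= G y by exact: supersolution_term_ge0.
have sG : (\esum_(y in [set: X]) (G y)%:E \is a fin_num)%E.
  rewrite ge0_fin_numE; first exact: le_lt_trans fs (ltry _).
  by apply: esum_ge0 => y _; rewrite lee_fin.
have sA : (\esum_(y in [set: X]) (A * b x y)%:E = (A * degree x)%:E)%E.
  by rewrite esumZ// esum_degree.
have -> : schroedinger p m b c f x =
    (m x)^-1 * (rsum (fun y => b x y * ppow p (f x - f y)) + c x * A).
  by rewrite /schroedinger -/A; ring.
rewrite mulr_ge0 ?invr_ge0 ?(ltW m0)//.
have -> : rsum (fun y => b x y * ppow p (f x - f y)) =
    A * degree x - fine (\esum_(y in [set: X]) (G y)%:E)%E.
  rewrite /rsum.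
  have -> : EFin \o (fun y => b x y * ppow p (f x - f y)) =
      ((fun y => (A * b x y)%:E) \- (fun y => (G y)%:E))%E.
    by apply/funext => y /=; rewrite -EFinB; congr EFin; rewrite /G; ring.
  rewrite esumB.
  - by rewrite sA -(fineK sG) -EFinB.
  - rewrite summableE; under eq_esum do rewrite abse_EFin ger0_norm ?mulr_ge0//.
    by rewrite sA.
  - rewrite summableE; under eq_esum do rewrite abse_EFin ger0_norm//.
    exact: sG.
  - by move=> y _; rewrite lee_fin mulr_ge0.
  - by move=> y _; rewrite lee_fin.
have : fine (\esum_(y in [set: X]) (G y)%:E)%E <= (c x + degree x) * A.
  by rewrite -lee_fin fineK.
lra.
Qed.

End supersolutions.

(** * Finiteness and lower semicontinuity of the energy *)

Section energy_facts.
Context {R : realType} {X : countType}.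
Variables (p : R) (b : X -> X -> R).
Hypotheses (p_gt1 : 1 < p) (b_graph : connected_graph b).

Let p_gt0 : 0 < p. Proof. exact: lt_trans ltr01 p_gt1. Qed.
Let b_ge0 x y : 0 <= b x y. Proof. by case: b_graph. Qed.
Let b_sym x y : b x y = b y x. Proof. by case: b_graph. Qed.
Let b_diag x : b x x = 0. Proof. by case: b_graph. Qed.

Definition dirichlet (phi : X -> R) : \bar R :=
  (\esum_(z in [set: X * X]) (b z.1 z.2 * `|phi z.1 - phi z.2| `^ p)%:E)%E.

Definition potential (c phi : X -> R) : R :=
  \sum_(x \in [set: X]) c x * `|phi x| `^ p.

Lemma energyE c phi :
  energy p b c phi = (2^-1%:E * dirichlet phi + (potential c phi)%:E)%E.
Proof. by []. Qed.

Lemma dirichlet_ge0 phi : (0 <= dirichlet phi)%E.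
Proof. by apply: esum_ge0 => z _; rewrite lee_fin mulr_ge0 ?powR_ge0. Qed.

Lemma finitely_supported_sub (T : set X) (phi : X -> R) :
  finite_set T -> (forall x, ~ T x -> phi x = 0) -> finitely_supported phi.
Proof.
move=> finT phi0; apply: sub_finite_set finT => x /= /eqP phix.
by apply: contrapT => /phi0.
Qed.

Lemma potential_sub (T : set X) c phi : (forall x, ~ T x -> phi x = 0) ->
  potential c phi = \sum_(x \in T) c x * `|phi x| `^ p.
Proof.
move=> phi0; apply/esym/fsbig_widen => // x [_ /= /phi0 ->].
by rewrite normr0 powR0 ?gt_eqF// mulr0.
Qed.

Lemma potential_shift c (e : R) phi : finitely_supported phi ->
  potential (fun x => c x + e) phi =
    potential c phi + e * potential (fun=> 1) phi.
Proof.
move=> fphi.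
have phi0 x : ~ [set x | phi x != 0] x -> phi x = 0.
  by move=> /negP; rewrite negbK => /eqP.
rewrite !(potential_sub _ phi0) mulr_fsumr -fsbig_split//.
by apply: eq_fsbigr => x _ /=; rewrite mulrDl mul1r.
Qed.

Lemma powR_le_potential1 phi x : finitely_supported phi ->
  `|phi x| `^ p <= potential (fun=> 1) phi.
Proof.
move=> fphi; have phi0 y : ~ (x |` [set x | phi x != 0]) y -> phi y = 0.
  by move=> /not_orP[_ /negP]; rewrite negbK => /eqP.
rewrite (potential_sub _ phi0) (fsbigD1 x)/=; last 2 first.
- by rewrite finite_setU; split.
- by left.
rewrite mul1r lerDl; apply: fsumr_ge0 => y _.
by rewrite mul1r powR_ge0.
Qed.

Lemma esum_pair (k : X -> R) (h : X -> X -> R) : (forall x, 0 <= k x) ->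
  (forall x y, 0 <= h x y) ->
  (\esum_(z in [set: X * X]) (k z.1 * h z.1 z.2)%:E =
   \esum_(x in [set: X]) ((k x)%:E * \esum_(y in [set: X]) (h x y)%:E))%E.
Proof.
move=> k0 h0; have -> : [set: X * X] = [set: X] `*`` (fun=> [set: X]).
  by apply/seteqP; split=> z.
rewrite -(@esum_esum _ _ _ _ _ (fun x y => (k x * h x y)%:E)).
  by apply: eq_esum => x _; rewrite esumZ.
by move=> x y _ _; rewrite lee_fin mulr_ge0.
Qed.

Lemma esum_swap (h : X -> X -> \bar R) :
  (\esum_(z in [set: X * X]) h z.1 z.2 = \esum_(z in [set: X * X]) h z.2 z.1)%E.
Proof.
rewrite (reindex_esum [set: X * X] _ (fun z => (z.2, z.1)))//.
by split=> // [[x y] [x' y'] _ _ [-> ->]//|[x y] _]; exists (y, x).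
Qed.

(** Bounding [|s - t|] by twice the larger of [|s|] and [|t|] separates the two endpoints of an
    edge. By symmetry of [b], what remains is a finite sum weighted by [degree]. *)
Lemma dirichlet_fin (phi : X -> R) : finitely_supported phi ->
  dirichlet phi \is a fin_num.
Proof.
move=> fphi; rewrite ge0_fin_numE ?dirichlet_ge0//.
pose k x := 2 `^ p * `|phi x| `^ p.
have k0 x : 0 <= k x by rewrite mulr_ge0 ?powR_ge0.
apply: (@le_lt_trans _ _ (\esum_(z in [set: X * X]) (k z.1 * b z.1 z.2)%:E
    + \esum_(z in [set: X * X]) (k z.2 * b z.2 z.1)%:E)%E).
  rewrite -esumD; last 2 first.
  - by move=> z _; rewrite lee_fin mulr_ge0.
  - by move=> z _; rewrite lee_fin mulr_ge0.
  apply: le_esum => z _; rewrite -EFinD lee_fin (b_sym z.2) -mulrDl mulrC.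
  rewrite ler_wpM2r// -mulrDr.
  apply: le_trans (_ : (2 * Num.max `|phi z.1| `|phi z.2|) `^ p <= _).
    apply: ge0_ler_powR; rewrite ?nnegrE ?(ltW p_gt0)//.
    apply: (le_trans (ler_normB _ _)).
    by rewrite mulr_natl mulr2n lerD// le_max lexx ?orbT.
  rewrite powRM// ?le_max ?normr_ge0// ler_wpM2l ?powR_ge0//.
  by have [_|_] := leP `|phi z.1| `|phi z.2|; rewrite (lerDl, lerDr) powR_ge0.
rewrite -(esum_swap (fun x y => (k x * b x y)%:E)) esum_pair//.
have -> : (\esum_(x in [set: X]) ((k x)%:E * \esum_(y in [set: X]) (b x y)%:E) =
    \esum_(x in [set: X]) (k x * degree b x)%:E)%E.
  by apply: eq_esum => x _; rewrite esum_degree.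
rewrite esum_finite_support ?ltry//.
  by move=> x; rewrite mulr_ge0 ?degree_ge0.
apply: sub_finite_set fphi => x /=; apply: contra => /eqP phi0.
rewrite /k phi0 normr0 powR0; last by rewrite gt_eqF.
by rewrite mulr0 mul0r.
Qed.

(** Isolates the sum with non-negative terms, to which Fatou's lemma applies. *)
Lemma energy_le_fin (c phi : X -> R) e : finitely_supported phi ->
  (energy p b c phi <= e%:E)%E =
    (dirichlet phi <= (2 * (e - potential c phi))%:E)%E.
Proof.
move=> fphi; rewrite energyE -(fineK (dirichlet_fin fphi)).
rewrite -EFinM -EFinD !lee_fin.
by apply/idP/idP; lra.
Qed.

Lemma energy_fin (c phi : X -> R) : finitely_supported phi ->
  energy p b c phi \is a fin_num.
Proof.
by move=> fphi; rewrite energyE -(fineK (dirichlet_fin fphi)) -EFinM -EFinD.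
Qed.

(** The shift adds [e] times the p-th power of the l^p norm; this makes a non-negative energy
    coercive. *)
Lemma energy_shift c (e : R) phi : finitely_supported phi ->
  energy p b (fun x => c x + e) phi =
    (energy p b c phi + (e * potential (fun=> 1) phi)%:E)%E.
Proof. by move=> fphi; rewrite !energyE potential_shift// EFinD addeA. Qed.

(** All supports lie in the finite set [T], so the potential part converges; the Dirichlet part is
    lower semicontinuous by Fatou's lemma. *)
Lemma energy_le_cvg (F : set_system nat) (FF : ProperFilter F) (T : set X)
    (c : X -> R) (phi : nat -> X -> R) (v : X -> R) (a : nat -> R) (l : R) :
  finite_set T -> (forall n x, ~ T x -> phi n x = 0) ->
  (forall x, phi ^~ x @ F --> v x) -> a @ F --> l ->
  (\forall n \near F, energy p b c (phi n) <= (a n)%:E)%E ->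
  (energy p b c v <= l%:E)%E.
Proof.
move=> finT phi0 phiv al ephi.
have v0 x : ~ T x -> v x = 0.
  move=> Tx; have := phiv x; under eq_cvg do rewrite phi0//.
  by move=> /(cvg_unique _ (cvg_cst 0)) ->.
have cpow (h : nat -> R) (t : R) : h @ F --> t ->
    (`|h n| `^ p) @[n --> F] --> `|t| `^ p.
  move=> ht.
  apply: (@continuous_cvg _ _ _ F _ h (fun s : R => `|s| `^ p) t) => //.
  exact: continuous_powR_norm.
rewrite energy_le_fin; last exact: finitely_supported_sub v0.
apply: (@esum_le_cvg _ _ F _
    (fun n z => b z.1 z.2 * `|phi n z.1 - phi n z.2| `^ p) _
    (fun n => 2 * (a n - potential c (phi n)))).
- by move=> z; apply: cvgMr; apply: cpow; apply: cvgB.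
- apply: cvgMr; apply: cvgB => //.
  under eq_cvg do rewrite (potential_sub _ (phi0 _)) fsbig_finite//=.
  rewrite (potential_sub _ v0) fsbig_finite//=.
  apply: cvg_big => [|x _]; first exact: add_continuous.
  by apply: cvgMr; exact: cpow.
- apply: filterS ephi => n; rewrite energy_le_fin//.
  exact: finitely_supported_sub (phi0 n).
Qed.

End energy_facts.

(** * Minimisers of the energy above an obstacle, and their first variation *)

Section minimisers.
Context {R : realType} {X : countType}.
Variables (p : R) (b : X -> X -> R).
Hypotheses (p_gt1 : 1 < p) (b_graph : connected_graph b).

Let p_gt0 : 0 < p. Proof. exact: lt_trans ltr01 p_gt1. Qed.
Let b_ge0 x y : 0 <= b x y. Proof. by case: b_graph. Qed.
Let b_sym x y : b x y = b y x. Proof. by case: b_graph. Qed.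
Let b_diag x : b x x = 0. Proof. by case: b_graph. Qed.

Implicit Types (phi c : X -> R) (x y : X) (t : R).

Definition bump (phi : X -> R) (x : X) (t : R) (y : X) : R :=
  if y == x then phi y + t else phi y.

(** At [t = 0] this is the summand in [supersolution]. *)
Definition flux (phi : X -> R) x t y : R :=
  b x y * (ppow p (phi x + t) - ppow p (phi x + t - phi y)).

Lemma flux_ge0 phi x t y : (forall z, 0 <= phi z) -> 0 <= t ->
  0 <= flux phi x t y.
Proof.
by move=> phi0 t0; rewrite mulr_ge0// subr_ge0 ppow_le ?gerBl// addr_ge0.
Qed.

(** Convexity on each edge at [x]: the tangent at the new difference [phi x + t - phi y] bounds the
    old one from below. Ordered pairs count each edge twice, hence the factor 2. The terms are
    placed so that every sum is non-negative. *)
Lemma dirichlet_bump phi x t : (forall z, 0 <= phi z) -> 0 <= t ->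
  (dirichlet p b (bump phi x t)
     + (2 * (p * t))%:E * (\esum_(y in [set: X]) (flux phi x t y)%:E)
   <= dirichlet p b phi
     + (2 * (p * t) * (ppow p (phi x + t) * degree b x))%:E)%E.
Proof.
move=> phi0 t0; set A := ppow p (phi x + t).
have A0 : 0 <= A by rewrite ppow_ge0// addr_ge0.
have pt0 : 0 <= p * t by rewrite mulr_ge0// ltW.
(* [k] turns sums over the neighbours of [x] into sums over pairs, so that the inequality can be
   checked pair by pair. *)
pose k z : R := p * t * (z == x)%:R.
have k0 z : 0 <= k z by rewrite mulr_ge0.
have row (h : X -> R) : (forall y, 0 <= h y) ->
    (\esum_(z in [set: X * X]) (k z.1 * h z.2)%:E =
      (p * t)%:E * \esum_(y in [set: X]) (h y)%:E)%E.
  move=> h0; rewrite (@esum_pair _ _ k (fun=> h))//.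
  rewrite -[RHS](@esum_set1 _ _ x (fun=> _)).
    rewrite [RHS]esum_mkcond; apply: eq_esum => z _.
    by rewrite /k in_set1; case: eqP => _; rewrite ?mulr1// mulr0 mul0e.
  by rewrite mule_ge0 ?lee_fin// esum_ge0// => y _; rewrite lee_fin.
have both (h : X -> R) : (forall y, 0 <= h y) ->
    (\esum_(z in [set: X * X]) (k z.1 * h z.2 + k z.2 * h z.1)%:E =
      (2 * (p * t))%:E * \esum_(y in [set: X]) (h y)%:E)%E.
  move=> h0; under eq_esum do rewrite EFinD.
  rewrite esumD; last 2 first.
  - by move=> z _; rewrite lee_fin; exact: mulr_ge0.
  - by move=> z _; rewrite lee_fin; exact: mulr_ge0.
  rewrite -(esum_swap (fun y z => (k y * h z)%:E)) row//.
  by rewrite mulr_natl mulr2n EFinD [RHS]ge0_muleDl ?lee_fin.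
have flux0 y := flux_ge0 x y phi0 t0.
have Ab0 y : 0 <= A * b x y by rewrite mulr_ge0.
rewrite [(_ * (A * _))%:E]EFinM [(A * _)%:E]EFinM -(esum_degree b_graph).
rewrite -[(A%:E * _)%E]esumZ// -!both//.
have kh0 (h : X -> R) : (forall y, 0 <= h y) ->
    forall z : X * X, 0 <= k z.1 * h z.2 + k z.2 * h z.1.
  by move=> h0 z; rewrite addr_ge0// mulr_ge0.
have grad0 (psi : X -> R) z : 0 <= b z.1 z.2 * `|psi z.1 - psi z.2| `^ p.
  by rewrite mulr_ge0 ?powR_ge0.
rewrite -!esumD; last 4 first.
- by move=> z _; rewrite lee_fin; exact: grad0.
- by move=> z _; rewrite lee_fin; exact: (kh0 _ Ab0).
- by move=> z _; rewrite lee_fin; exact: grad0.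
- by move=> z _; rewrite lee_fin; exact: (kh0 _ flux0).
have tangent y : `|phi x + t - phi y| `^ p <=
    `|phi x - phi y| `^ p + p * t * ppow p (phi x + t - phi y).
  have := powR_tangent p_gt1 (phi x + t - phi y) (phi x - phi y).
  have -> : phi x - phi y - (phi x + t - phi y) = - t by ring.
  lra.
have edge y : b x y * `|phi x + t - phi y| `^ p + p * t * flux phi x t y <=
    b x y * `|phi x - phi y| `^ p + p * t * (A * b x y).
  have := ler_wpM2l (b_ge0 x y) (tangent y).
  rewrite /flux -/A; lra.
apply: le_esum => -[z1 z2] _ /=; rewrite -!EFinD lee_fin /bump /k.
have [->|z1x] := eqVneq z1 x; have [->|z2x] := eqVneq z2 x.
- by rewrite /flux b_diag !(mul0r, mulr0, addr0).
- by rewrite mulr0 mulr1 !mul0r !addr0.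
- rewrite mulr0 mulr1 !mul0r !add0r (b_sym z1).
  by rewrite (distrC (phi z1)) (distrC (phi z1)).
- by rewrite !(mulr0, mul0r, addr0).
Qed.

Lemma potential_bump c phi x t : finitely_supported phi ->
  potential p c (bump phi x t) - potential p c phi
    = c x * (`|phi x + t| `^ p - `|phi x| `^ p).
Proof.
move=> fphi; pose T := x |` [set y | phi y != 0].
have finT : finite_set T by rewrite finite_setU; split.
have phi0 y : ~ T y -> phi y = 0.
  by move=> /not_orP[_ /negP]; rewrite negbK => /eqP.
have bump0 y : ~ T y -> bump phi x t y = 0.
  move=> Ty; rewrite /bump; case: eqP => [yx|_]; last exact: phi0.
  by case: Ty; left.
rewrite (potential_sub p_gt1 _ phi0) (potential_sub p_gt1 _ bump0).
have Tx : T x by left.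
rewrite !(@fsbigD1 _ _ _ _ x T _ finT Tx) /=.
have -> : \sum_(y \in T `\ x) c y * `|bump phi x t y| `^ p =
    \sum_(y \in T `\ x) c y * `|phi y| `^ p.
  apply: eq_fsbigr => y; rewrite inE => -[_ /= /eqP/negbTE yx].
  by rewrite /bump yx.
by rewrite /bump eqxx; ring.
Qed.

Lemma finitely_supported_bump phi x t : finitely_supported phi ->
  finitely_supported (bump phi x t).
Proof.
move=> fphi; apply: (@finitely_supported_sub _ _ (x |` [set y | phi y != 0])).
  by rewrite finite_setU; split.
move=> y /not_orP[/= yx /negP]; rewrite negbK => /eqP phi0.
by rewrite /bump; case: eqP.
Qed.

(* The two tangent inequalities at [phi x] and [phi x + t] bound the potential
   term, whatever the sign of [c x]. *)
Lemma flux_le c phi x t : finitely_supported phi -> (forall z, 0 <= phi z) ->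
  0 < t -> (energy p b c phi <= energy p b c (bump phi x t))%E ->
  (\esum_(y in [set: X]) (flux phi x t y)%:E <=
    (degree b x * ppow p (phi x + t) + Num.max (c x) 0 * ppow p (phi x + t)
      + Num.min (c x) 0 * ppow p (phi x))%:E)%E.
Proof.
move=> fphi phi0 t0 emin.
set A := ppow p (phi x + t); set A0 := ppow p (phi x).
have fb := finitely_supported_bump x t fphi.
have := dirichlet_bump x phi0 (ltW t0); rewrite -/A.
move: emin; rewrite !energyE.
have := potential_bump c x t fphi.
rewrite -(fineK (dirichlet_fin p_gt1 b_graph fphi)).
rewrite -(fineK (dirichlet_fin p_gt1 b_graph fb)).
set d := fine _; set d' := fine _.
set v := potential _ _ _; set v' := potential _ _ _.
set s := esum _ _; move=> dv; rewrite -!EFinM -!EFinD !lee_fin => demin ds.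
have pt0 : 0 < 2 * (p * t) by rewrite !mulr_gt0.
have s0 : (0 <= s)%E by apply: esum_ge0 => y _; rewrite lee_fin flux_ge0// ltW.
have sfin : s \is a fin_num.
  rewrite ge0_fin_numE//; move: ds; case: (s) s0 => [r _ _|_|//].
    exact: ltry.
  by rewrite gt0_muley ?lte_fin// addey.
rewrite -(fineK sfin) lee_fin; move: ds.
rewrite -(fineK sfin) -!EFinM -!EFinD lee_fin.
set r := fine s => ds /=.
rewrite -(ler_pM2l pt0).
have lo : p * t * A0 <= `|phi x + t| `^ p - `|phi x| `^ p.
  have := powR_tangent p_gt1 (phi x) (phi x + t); rewrite -/A0.
  have -> : phi x + t - phi x = t by ring.
  lra.
have hi : `|phi x + t| `^ p - `|phi x| `^ p <= p * t * A.
  have := powR_tangent p_gt1 (phi x + t) (phi x); rewrite -/A.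
  have -> : phi x - (phi x + t) = - t by ring.
  lra.
set e := `|phi x + t| `^ p - `|phi x| `^ p in lo hi dv.
have : c x * e <= p * t * (Num.max (c x) 0 * A + Num.min (c x) 0 * A0).
  have [cx|cx] := leP 0 (c x).
    by rewrite mul0r addr0 mulrCA ler_wpM2l.
  by rewrite mul0r add0r mulrCA ler_wnM2l// ltW.
lra.
Qed.

(** A one-sided first variation: only upward moves are sure to respect an obstacle from below.
    Instead of differentiating, [flux_le] is used for positive increments, which then tend to 0
    under Fatou's lemma. *)
Lemma minimiser_supersolution c phi x : finitely_supported phi ->
  (forall z, 0 <= phi z) ->
  (forall t, 0 < t -> (energy p b c phi <= energy p b c (bump phi x t))%E) ->
  supersolution p b (c x) phi x.
Proof.
move=> fphi phi0 emin; pose t n : R := n.+1%:R^-1.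
have t0 : t @ \oo --> 0 by exact: cvg_harmonic.
have tphi : phi x + t n @[n --> \oo] --> phi x.
  by rewrite -[X in _ --> X]addr0; apply: cvgD => //; exact: cvg_cst.
have tA : ppow p (phi x + t n) @[n --> \oo] --> ppow p (phi x).
  apply: (@continuous_cvg _ _ _ _ _ _ (ppow p)) => //.
  exact: continuous_ppow.
rewrite /supersolution.
apply: (@esum_le_cvg _ _ \oo _ (fun n y => flux phi x (t n) y) _
  (fun n => degree b x * ppow p (phi x + t n) +
     Num.max (c x) 0 * ppow p (phi x + t n) +
     Num.min (c x) 0 * ppow p (phi x))).
- move=> y; apply: cvgMr; apply: cvgB => //.
  apply: (@continuous_cvg _ _ _ _ _ (fun n => phi x + t n - phi y) (ppow p)).
    exact: continuous_ppow.
  by apply: cvgB => //; exact: cvg_cst.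
(* In the limit both parts of [c x] have the same factor, and they add up to [c x]. *)
- rewrite (_ : (c x + degree b x) * _ = degree b x * ppow p (phi x) +
     Num.max (c x) 0 * ppow p (phi x) + Num.min (c x) 0 * ppow p (phi x)).
    by apply: cvgD; [apply: cvgD; exact: cvgMr|exact: cvg_cst].
  by have [cx|cx] := leP 0 (c x); ring.
- near=> n; have tn0 : 0 < t n by rewrite invr_gt0.
  by apply: flux_le => //; exact: emin.
Unshelve. all: end_near. Qed.

(** The direct method: coercivity bounds a minimising sequence at each vertex, and the energy is
    lower semicontinuous along its ultrafilter limit. *)
Lemma exists_minimiser (T : set X) (c l : X -> R) (e : R) :
  finite_set T -> 0 < e ->
  (forall x, 0 <= l x) -> (forall x, ~ T x -> l x = 0) ->
  (forall phi x, finitely_supported phi ->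
     ((e * `|phi x| `^ p)%:E <= energy p b c phi)%E) ->
  exists phi, [/\ forall x, l x <= phi x, forall x, ~ T x -> phi x = 0 &
    forall psi, (forall x, l x <= psi x) -> (forall x, ~ T x -> psi x = 0) ->
      (energy p b c phi <= energy p b c psi)%E].
Proof.
move=> finT e0 l0 lT coercive.
pose feas : set (X -> R) :=
  [set psi | (forall x, l x <= psi x) /\ (forall x, ~ T x -> psi x = 0)].
have feas_fin psi : feas psi -> finitely_supported psi.
  by move=> [_]; exact: finitely_supported_sub.
pose S := [set fine (energy p b c psi) | psi in feas].
have S0 : has_inf S.
  split; first by exists (fine (energy p b c l)), l.
  (* Coercivity bounds the energy below only through a vertex; without vertices there is a single
     function. *)
  case: (pselect (exists x : X, True)) => [[x _]|noX].
    exists 0 => _ [psi /feas_fin fpsi <-]; apply: fine_ge0.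
    apply: le_trans (coercive psi x fpsi).
    by rewrite lee_fin mulr_ge0 ?powR_ge0 ?ltW.
  exists (fine (energy p b c l)) => _ [psi _ <-].
  suff -> : psi = l by [].
  by apply/funext => x; case: noX; exists x.
have /choice[phi phiP] n : exists psi, feas psi /\
    (energy p b c psi <= (inf S + n.+1%:R^-1)%:E)%E.
  have n0 : 0 < n.+1%:R^-1 :> R by rewrite invr_gt0.
  have [_ [psi fpsi <-] lt] := inf_adherent n0 S0.
  exists psi; split => //.
  rewrite -(fineK (energy_fin p_gt1 b_graph c (feas_fin _ fpsi))).
  by rewrite lee_fin ltW.
have phi_ge0 n x : 0 <= phi n x.
  by apply: le_trans (l0 x) _; case: (phiP n) => -[].
(* Every term of the minimising sequence has energy at most [inf S + 1]; [B] solves the coercivity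
   inequality for that value. *)
pose B := ((inf S + 1) / e) `^ p^-1.
have phiB n x : phi n x <= B.
  have [fphi ephi] := phiP n.
  have := le_trans (coercive (phi n) x (feas_fin _ fphi)) ephi.
  rewrite lee_fin ger0_norm// mulrC -ler_pdivlMr// => h.
  rewrite leNgt; apply/negP => /(gt0_ltr_powR p_gt0) h2.
  have : B `^ p < phi n x `^ p by apply: h2; rewrite nnegrE ?powR_ge0.
  rewrite ltNge => /negP; apply; apply: le_trans h _.
  have : (inf S + n.+1%:R^-1) / e <= (inf S + 1) / e.
    by rewrite ler_pM2r ?invr_gt0// lerD2l invf_le1// ler1n.
  move=> h3; apply: (le_trans h3).
  (* On a negative base [powR] with exponent 1 has the default value 1, which is still an upper
     bound. *)
  rewrite /B -powRrM mulVf ?gt_eqF//; have [Y0|Y0] := leP 0 ((inf S + 1) / e).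
    by rewrite powRr1.
  by rewrite lt0_powR1// (le_trans (ltW Y0)).
have [U [UU oU]] := ultraFilterLemma (@eventually_filter).
have /choice[v phiv] x : exists y : R, phi ^~ x @ U --> y.
  apply: (@ultra_cvg_bounded _ _ _ _ _ B).
  by near=> n; rewrite phi_ge0 phiB.
exists v; split.
- move=> x; apply: (@cvgr_to_ge _ U _ _ (phi ^~ x) _ _ (phiv x)); near=> n.
  by case: (phiP n) => -[].
- move=> x Tx; have := phiv x.
  have -> : phi ^~ x = cst 0 by apply/funext => n; case: (phiP n) => -[_ ->].
  by move=> /(cvg_unique _ (cvg_cst 0)) ->.
- move=> psi lpsi Tpsi.
  have fpsi : feas psi by [].
  rewrite -(fineK (energy_fin p_gt1 b_graph c (feas_fin _ fpsi))).
  apply: (@le_trans _ _ (inf S)%:E).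
    apply: (@energy_le_cvg _ _ _ _ p_gt1 b_graph U _ T c phi v
      (fun n => inf S + n.+1%:R^-1)) => //.
    + by move=> n; case: (phiP n) => -[].
    + rewrite -[X in _ --> X]addr0; apply: cvgD; first exact: cvg_cst.
      by apply: cvg_trans (@cvg_harmonic R) => A /oU.
    + by near=> n; case: (phiP n).
  by rewrite lee_fin; apply: ge_inf; [case: S0|exists psi].
Unshelve. all: end_near. Qed.

End minimisers.

(** * Consequences of Hardy inequalities, and the limit of the minimisers *)

Section exhaustion.
Context {R : realType} {X : countType}.
Variables (p : R) (b : X -> X -> R) (m c : X -> R).
Hypotheses (p_gt1 : 1 < p) (b_graph : connected_graph b).
Hypotheses (m_gt0 : forall x, 0 < m x) (Q_ge0 : energy_nonneg p b c).

Let p_gt0 : 0 < p. Proof. exact: lt_trans ltr01 p_gt1. Qed.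

(** The Hardy inequality in the form that Fatou's lemma takes. *)
Lemma hardy_esum_le g : hardy_weights p m b c g ->
  exists2 C : R, 0 < C & forall phi e, finitely_supported phi ->
    (energy p b c phi <= e%:E)%E ->
    (\esum_(x in [set: X]) (m x * `|g x| * `|phi x| `^ p)%:E <= (e / C)%:E)%E.
Proof.
move=> [C C0 hC]; exists C => // phi e fphi ephi.
have := le_trans (hC phi fphi) ephi; rewrite lee_fin => h.
rewrite esum_finite_support.
- by rewrite lee_fin ler_pdivlMr// mulrC.
- by move=> x; rewrite !mulr_ge0 ?powR_ge0// ltW.
- apply: sub_finite_set fphi => x /=; apply: contra => /eqP ->.
  by rewrite normr0 powR0 ?mulr0// gt_eqF.
Qed.

Lemma hardy_pointwise_bound g o e : hardy_weights p m b c g -> g o != 0 ->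
  exists B : R, forall phi, finitely_supported phi -> 0 <= phi o ->
    (energy p b c phi <= e%:E)%E -> phi o <= B.
Proof.
move=> /hardy_esum_le[C C0 hC] go.
have w0 : 0 < m o * `|g o| by rewrite mulr_gt0 ?normr_gt0.
(* The summand 1 covers [phi o <= 1]; above 1, [phi o] is at most its p-th power. *)
exists (1 + e / C / (m o * `|g o|)) => phi fphi phio ephi.
have : m o * `|g o| * `|phi o| `^ p <= e / C.
  rewrite -lee_fin; apply: le_trans (hC _ _ fphi ephi).
  by apply: esum_ge; exists [set o] => //; rewrite fsbig_set1.
rewrite mulrC -ler_pdivlMr// ger0_norm// => h.
have [o1|o1] := leP (phi o) 1.
  by apply: (le_trans o1); rewrite lerDl (le_trans _ h)// powR_ge0.
apply: le_trans (_ : phi o `^ p <= _); first by rewrite le1r_powR// ltW.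
by apply: (le_trans h); rewrite lerDr.
Qed.

(* The approximants minimise the energy, shifted by [1 / (n + 1)] to make it
   coercive, over the functions above [l] supported in the n-th set of an
   exhaustion of [X]. *)
Lemma exists_supersolution_above g o (l : X -> R) :
  hardy_weights p m b c g -> g o != 0 ->
  (forall x, 0 <= l x) -> finitely_supported l ->
  exists (U : set_system nat) (phi : nat -> X -> R) (v : X -> R) (e : R),
  [/\ UltraFilter U,
      forall n, finitely_supported (phi n) /\ (energy p b c (phi n) <= e%:E)%E,
      forall x, phi ^~ x @ U --> v x, forall x, l x <= v x &
      forall x, supersolution p b (c x) v x].
Proof.
move=> hg go l0 fl.
(* The support of [l] lies in every [T n], so [l] itself is always a competitor. *)
pose T n := [set x | l x != 0] `|` [set x | (pickle x < n)%N].
have finT n : finite_set (T n).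
  rewrite finite_setU; split => //.
  apply: (@sub_finite_set _ _ (pickle @^-1` `I_n)); first by move=> x.
  by apply: finite_preimage (finite_II n) => x y _ _; exact: (pcan_inj pickleK).
have lT n x : ~ T n x -> l x = 0.
  by move=> /not_orP[/negP]; rewrite negbK => /eqP.
pose eps n : R := n.+1%:R^-1.
have eps0 n : 0 < eps n by rewrite invr_gt0.
have eps1 n : eps n <= 1 by rewrite invf_le1// ler1n.
pose cn n x := c x + eps n.
have coercive n phi x : finitely_supported phi ->
    ((eps n * `|phi x| `^ p)%:E <= energy p b (cn n) phi)%E.
  move=> fphi; rewrite energy_shift//.
  apply: le_trans (_ : (eps n * potential p (fun=> 1) phi)%:E <= _)%E.
    by rewrite lee_fin ler_wpM2l ?(ltW (eps0 _))// powR_le_potential1.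
  by apply: leeDr; exact: Q_ge0.
have /choice[phi phiP] n := exists_minimiser p_gt1 b_graph (finT n) (eps0 n)
  l0 (lT n) (coercive n).
have fphi n : finitely_supported (phi n).
  by case: (phiP n) => _ + _; exact: finitely_supported_sub.
have phi0 n x : 0 <= phi n x by apply: le_trans (l0 x) _; case: (phiP n).
have pot0 psi : 0 <= potential p (fun=> 1) psi.
  by apply: fsumr_ge0 => x _; rewrite mul1r powR_ge0.
(* Comparison with the competitor [l] and [eps n <= 1] give this bound for all [n]. *)
pose e := fine (energy p b (fun x => c x + 1) l).
have ephi n : (energy p b c (phi n) <= e%:E)%E.
  apply: (@le_trans _ _ (energy p b (cn n) (phi n))).
    by rewrite energy_shift// leeDl// lee_fin mulr_ge0 ?(ltW (eps0 _)).
  apply: (@le_trans _ _ (energy p b (cn n) l)).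
    by case: (phiP n) => _ _; apply => //; exact: lT.
  rewrite /e fineK; last exact: energy_fin.
  rewrite !energy_shift//; apply: leeD2l.
  by rewrite lee_fin ler_wpM2r.
have [U [UU oU]] := ultraFilterLemma (@eventually_filter).
have super x : \forall n \near U, supersolution p b (cn n x) (phi n) x.
  (* From this index on [x] lies in [T n], so raising the value at [x] stays admissible. *)
  apply: oU; exists (pickle x).+1 => // n /= xn.
  apply: minimiser_supersolution => // t t0.
  case: (phiP n) => lphi phiT; apply => y.
    rewrite /bump; case: eqP => _; last exact: lphi.
    by apply: le_trans (lphi y) _; rewrite lerDl ltW.
  move=> Ty; rewrite /bump; case: eqP => [yx|_]; last exact: phiT.
  by case: Ty; right; rewrite yx.
have [B hB] := hardy_pointwise_bound e hg go.
have /choice[v phiv] x : exists y : R, phi ^~ x @ U --> y.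
  (* [c + 1] dominates all shifted potentials, so one Harnack constant serves every [n]. *)
  have cn1 n y : cn n y <= c y + 1 by rewrite lerD2l.
  have [C C0 hC] := supersolution_comparable p_gt1 b_graph _ cn1 phi0 super o x.
  apply: (@ultra_cvg_bounded _ _ _ _ _ (C * B)); near=> n.
  rewrite phi0/=; apply: (@le_trans _ _ (C * phi n o)); first by near: n.
  by rewrite ler_wpM2l// hB.
exists U, phi, v, e; split => //.
- move=> x; apply: (@cvgr_to_ge _ U _ _ (phi ^~ x) _ _ (phiv x)); near=> n.
  by case: (phiP n).
- move=> x; apply: (@supersolution_cvg _ _ _ _ p_gt1 U _ (cn^~ x) phi) => //.
  rewrite -[X in _ --> X]addr0; apply: cvgD; first exact: cvg_cst.
  by apply: cvg_trans (@cvg_harmonic R) => A /oU.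
Unshelve. all: end_near. Qed.

End exhaustion.

Theorem theorem4p3 (R : realType) (X : countType) (p : R)
    (m : X -> R) (b : X -> X -> R) (c : X -> R) (u : X -> R)
    (p_gt1 : 1 < p)
    (X_infinite : infinite_set [set: X])
    (m_gt0 : forall x, 0 < m x)
    (b_graph : connected_graph b)
    (Q_ge0 : energy_nonneg p b c)
    (Q_subcritical : subcritical p m b c)
    (u_minimal : minimal_growth_solution p m b c u) :
  hardy_weights p m b c `<=` ell 1 (fun x => `|u x| `^ p * m x) /\
  (forall g : X -> R, hardy_weights p m b c g ->
     ell p (fun x => `|g x| * m x) u).
Proof.
have p_gt0 : 0 < p by exact: lt_trans ltr01 p_gt1.
have [g0 [o [hg0 g0o]]] : exists g o, hardy_weights p m b c g /\ g o != 0.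
  (* The zero function is a Hardy weight because the energy is non-negative, so subcriticality
     provides a weight that is nonzero somewhere. *)
  apply: contrapT => nog; apply: Q_subcritical.
  apply/seteqP; split=> [g hg|_ ->] /=.
    apply/funext => x; apply/eqP; apply: contrapT => /negP gx.
    by apply: nog; exists g, x.
  exists 1 => // phi fphi; rewrite fsbig1 ?mulr0; first exact: Q_ge0.
  by move=> x _; rewrite normr0 mulr0 mul0r.
have [_ [K0 [finK0 u_sol u_min]]] := u_minimal.
pose K := o |` K0.
have finK : finite_set K by rewrite finite_setU; split.
(* The absolute value is there because the sign of [u] on [K0] is unknown; the summand 1 makes the
   limit positive at [o]. *)
pose l x := if x \in K then 1 + `|u x| else 0.
have l0 x : 0 <= l x by rewrite /l; case: ifP => // _; rewrite addr_ge0.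
have fl : finitely_supported l.
  apply: sub_finite_set finK => x /=; rewrite /l.
  by case: ifPn => [|_]; rewrite ?eqxx// inE.
have [U [phi [v [e [UU phiP phiv lv vs]]]]] :=
  exists_supersolution_above p_gt1 b_graph m_gt0 Q_ge0 hg0 g0o l0 fl.
have v0 x : 0 <= v x by exact: le_trans (lv x).
have uvK x : K x -> `|u x| + 1 <= v x.
  by move=> Kx; apply: le_trans (lv x); rewrite /l mem_set// addrC.
have v_gt0 x : 0 < v x.
  (* The Harnack inequality for the constant sequence [v], from [x] to [o]: a zero at [x] would
     force [v o <= 0]. *)
  have vs_near y : \forall n \near U, supersolution p b (c y) v y.
    exact: nearW.
  have [C C0 hC] := @supersolution_comparable _ _ p b p_gt1 b_graph U _
    (fun=> c) c (fun=> v) (fun _ _ => lexx _) (fun=> v0) vs_near x o.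
  have /filter_ex[_ /= vo] := hC.
  rewrite lt_neqAle v0 andbT eq_sym; apply/eqP => vx0; move: vo.
  rewrite vx0 mulr0 leNgt => /negP; apply.
  by apply: lt_le_trans (uvK o _); [rewrite ltr_wpDl|left].
have uv x : `|u x| <= v x.
  have [Kx|Kx] := pselect (K x).
    by apply: le_trans (uvK x Kx); rewrite lerDl.
  have K0x : ~ K0 x by move=> K0x; apply: Kx; right.
  have [ux _] := u_sol x K0x; rewrite gtr0_norm//.
  apply: (u_min v K) => //.
  - exact: supersolution_formal_domain vs.
  - by move=> y; right.
  - move=> y _; split=> //.
    exact: supersolution_schroedinger_ge0.
  - move=> y Ky; apply: le_trans (uvK y Ky).
    by apply: (le_trans (ler_norm _)); rewrite lerDl.
have hardy_u g : hardy_weights p m b c g ->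
    (\esum_(x in [set: X]) (m x * `|g x| * `|u x| `^ p)%:E < +oo)%E.
  move=> /(hardy_esum_le p_gt1 m_gt0)[C C0 hC].
  apply: (@le_lt_trans _ _ (e / C)%:E); last exact: ltry.
  apply: (@le_trans _ _
    (\esum_(x in [set: X]) (m x * `|g x| * `|v x| `^ p)%:E)%E).
    apply: le_esum => x _.
    rewrite lee_fin ler_wpM2l ?mulr_ge0 ?(ltW (m_gt0 _))//.
    apply: ge0_ler_powR; rewrite ?nnegrE ?(ltW p_gt0)//.
    by rewrite (ger0_norm (v0 x)).
  apply: (@esum_le_cvg _ _ U _ (fun n x => m x * `|g x| * `|phi n x| `^ p) _
    (fun=> e / C)).
  - move=> x; apply: cvgMr.
    apply: (@continuous_cvg _ _ _ U _
      (phi ^~ x) (fun s : R => `|s| `^ p)) => //.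
    exact: continuous_powR_norm.
  - exact: cvg_cst.
  - by near=> n; case: (phiP n) => fphi ephi; exact: hC.
split=> [g|g] /hardy_u; rewrite /ell /=; congr (_ < _)%E; apply: eq_esum => x _.
  by congr EFin; rewrite powRr1//; ring.
by congr EFin; ring.
Unshelve. all: end_near. Qed.
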